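(* Let $b_0\in\mathbb{D}$ and $b_1,b_2\in\mathbb{R}$ be such that $$\varphi(z)=b_0+\frac{b_1z}{1-\overline{b_0}z}$$ is a holomorphic self-map of $\mathbb{D}$, and let $$\psi(z)=\frac{b_2}{1-\overline{b_0}z}.$$ Then the Hermitian weighted composition operator $W_{\psi,\varphi}$ on $H^2(\mathbb{D})$ is complex symmetric with conjugation $\mathcal{J}C_{-\lambda z}$, where $\lambda$ is any unimodular constant with $\lambda\overline{b_0}+b_0=0$.
   Context: $\mathbb{D}$ is the open unit disk in $\mathbb{C}$; $H^2(\mathbb{D})$ is the classical Hardy–Hilbert space on $\mathbb{D}$. For $\psi$ holomorphic on $\mathbb{D}$ and $\varphi$ a holomorphic self-map of $\mathbb{D}$, the weighted composition operator is $W_{\psi,\varphi}f=\psi\cdot(f\circ\varphi)$; $C_\varphi=W_{1,\varphi}$ is the composition operator, and $C_{\mu z}$ denotes $C_\varphi$ with $\varphi(z)=\mu z$. A conjugation on a complex Hilbert space is an anti-linear, isometric map $\mathcal{C}$ with $\mathcal{C}^2=I$. A bounded operator $T$ is complex symmetric with conjugation $\mathcal{C}$ if $\mathcal{C}T=T^*\mathcal{C}$. $\mathcal{J}$ is the conjugation on $H^2(\mathbb{D})$ given by $\mathcal{J}(\sum_{n\ge0}a_nz^n)=\sum_{n\ge0}\overline{a_n}z^n$. *)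

(* Defs.v *)
From Stdlib Require Import Reals Lra ClassicalEpsilon.
From Coquelicot Require Import Coquelicot.
Open Scope C_scope.

Definition disk (z : C) : Prop := (Cmod z < 1)%R.

(* Functions on the disk are represented by total functions on C whose values
   outside the disk are irrelevant; [eq_disk] is equality of such functions. *)
Definition eq_disk (f g : C -> C) : Prop := forall z, disk z -> f z = g z.

Definition holomorphic_on_disk (f : C -> C) : Prop :=
  forall z, disk z -> @ex_derive C_AbsRing C_NormedModule f z.

Definition holomorphic_self_map (phi : C -> C) : Prop :=
  holomorphic_on_disk phi /\ forall z, disk z -> disk (phi z).

Definition is_taylor (f : C -> C) (a : nat -> C) : Prop :=
  forall z, disk z -> @is_pseries C_AbsRing C_NormedModule a z (f z).

(* Such an f is automatically holomorphic on the disk. *)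
Definition H2 (f : C -> C) : Prop :=
  exists a, is_taylor f a /\ ex_series (fun n => (Cmod (a n) ^ 2)%R).

(* By [taylor_eq] below this is the unique Taylor sequence of f when f has one;
   otherwise it is unspecified. *)
Definition taylor (f : C -> C) : nat -> C :=
  epsilon (inhabits (fun _ => RtoC 0)) (is_taylor f).

Definition CSeries (u : nat -> C) : C :=
  (Series (fun n => Re (u n)), Series (fun n => Im (u n))).

Definition H2inner (f g : C -> C) : C :=
  CSeries (fun n => taylor f n * Cconj (taylor g n)).

Definition H2norm (f : C -> C) : R := sqrt (Re (H2inner f f)).

(* The second clause says that T is well defined on functions on the disk. *)
Definition H2_map (T : (C -> C) -> (C -> C)) : Prop :=
  (forall f, H2 f -> H2 (T f)) /\
  (forall f g, H2 f -> H2 g -> eq_disk f g -> eq_disk (T f) (T g)).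

Definition bounded_operator (T : (C -> C) -> (C -> C)) : Prop :=
  H2_map T /\
  (forall (alpha beta : C) f g, H2 f -> H2 g ->
     eq_disk (T (fun z => alpha * f z + beta * g z))
             (fun z => alpha * T f z + beta * T g z)) /\
  (exists M : R, forall f, H2 f -> (H2norm (T f) <= M * H2norm f)%R).

Definition is_adjoint (T S : (C -> C) -> (C -> C)) : Prop :=
  forall f g, H2 f -> H2 g -> H2inner (T f) g = H2inner f (S g).

Definition hermitian (T : (C -> C) -> (C -> C)) : Prop :=
  bounded_operator T /\ is_adjoint T T.

Definition conjugation (K : (C -> C) -> (C -> C)) : Prop :=
  H2_map K /\
  (forall (alpha beta : C) f g, H2 f -> H2 g ->
     eq_disk (K (fun z => alpha * f z + beta * g z))
             (fun z => Cconj alpha * K f z + Cconj beta * K g z)) /\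
  (forall f, H2 f -> H2norm (K f) = H2norm f) /\
  (forall f, H2 f -> eq_disk (K (K f)) f).

(* The adjoint of T is determined by [is_adjoint] up to [eq_disk], and
   [eq_disk (K (T f)) (S (K f))] does not depend on the choice of S. *)
Definition complex_symmetric_with (T K : (C -> C) -> (C -> C)) : Prop :=
  bounded_operator T /\ conjugation K /\
  exists S, bounded_operator S /\ is_adjoint T S /\
    forall f, H2 f -> eq_disk (K (T f)) (S (K f)).

Definition weighted_comp (psi phi : C -> C) (f : C -> C) : C -> C :=
  fun z => psi z * f (phi z).

Definition comp_op (phi : C -> C) : (C -> C) -> (C -> C) :=
  weighted_comp (fun _ => RtoC 1) phi.

Definition conj_J (f : C -> C) : C -> C :=
  fun z => CSeries (fun n => Cconj (taylor f n) * z ^ n).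

Lemma is_series_C_parts (u : nat -> C) (l : C) :
  @is_series C_AbsRing C_NormedModule u l ->
  is_series (fun n => Re (u n)) (Re l) /\ is_series (fun n => Im (u n)) (Im l).
Proof.
intros H; split.
- apply (filterlim_ext (fun n => Re (@sum_n C_AbelianMonoid u n))).
  + intros n; induction n as [|n IH].
    * now rewrite !sum_O.
    * now rewrite !sum_Sn, <- IH.
  + intros P [eps HP]; apply (H (fun y => P (Re y))); exists eps.
    intros y Hy; apply HP, Hy.
- apply (filterlim_ext (fun n => Im (@sum_n C_AbelianMonoid u n))).
  + intros n; induction n as [|n IH].
    * now rewrite !sum_O.
    * now rewrite !sum_Sn, <- IH.
  + intros P [eps HP]; apply (H (fun y => P (Im y))); exists eps.
    intros y Hy; apply HP, Hy.
Qed.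

Lemma pow_n_RtoC (x : R) (n : nat) : @pow_n C_Ring (RtoC x) n = RtoC (x ^ n).
Proof.
induction n as [|n IH]; [reflexivity|].
change (RtoC x * @pow_n C_Ring (RtoC x) n = RtoC (x * x ^ n)).
now rewrite IH, RtoC_mult.
Qed.

Lemma is_pseries_C_parts (a : nat -> C) (x : R) (l : C) :
  @is_pseries C_AbsRing C_NormedModule a (RtoC x) l ->
  is_pseries (fun n => Re (a n)) x (Re l) /\
  is_pseries (fun n => Im (a n)) x (Im l).
Proof.
intros H; destruct (is_series_C_parts _ _ H) as [H1 H2]; split.
- apply is_series_ext with (2 := H1); intros n.
  change (Re (@pow_n C_Ring (RtoC x) n * a n) = (@pow_n R_AbsRing x n * Re (a n))%R).
  rewrite pow_n_RtoC; unfold Re; simpl fst; simpl snd.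
  replace (@pow_n R_AbsRing x n) with (x ^ n)%R by (symmetry; exact (pow_n_pow x n)).
  simpl; ring.
- apply is_series_ext with (2 := H2); intros n.
  change (Im (@pow_n C_Ring (RtoC x) n * a n) = (@pow_n R_AbsRing x n * Im (a n))%R).
  rewrite pow_n_RtoC; unfold Im; simpl fst; simpl snd.
  replace (@pow_n R_AbsRing x n) with (x ^ n)%R by (symmetry; exact (pow_n_pow x n)).
  simpl; ring.
Qed.

Lemma pseries_coef_unique (a b : nat -> R) (f : R -> R) :
  (forall x, (Rabs x < 1)%R -> is_pseries a x (f x)) ->
  (forall x, (Rabs x < 1)%R -> is_pseries b x (f x)) -> forall n, a n = b n.
Proof.
intros Ha Hb n.
assert (Hr : forall c, (forall x, (Rabs x < 1)%R -> is_pseries c x (f x)) ->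
    Rbar_lt 0 (CV_radius c)).
{ intros c Hc.
  destruct (Rbar_lt_le_dec 0 (CV_radius c)) as [h|h]; [exact h|].
  exfalso; apply (CV_disk_outside c (/2)%R).
  - apply Rbar_le_lt_trans with (1 := h); simpl.
    rewrite Rabs_pos_eq; lra.
  - assert (E : ex_series (fun n => (c n * (/2) ^ n)%R)).
    { apply ex_series_ext with (fun k => scal (pow_n (/2)%R k) (c k)).
      - intros k; rewrite pow_n_pow.
        change ((/2) ^ k * c k = c k * (/2) ^ k)%R; ring.
      - eexists; apply Hc; rewrite Rabs_pos_eq; lra. }
    exact (ex_series_lim_0 _ E). }
apply PSeries_ext_recip; try (now apply Hr).
exists (mkposreal 1 Rlt_0_1); intros y Hy.
assert (Hy' : (Rabs y < 1)%R).
{ replace y with (y - 0)%R by ring; exact Hy. }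
now rewrite (is_pseries_unique _ _ _ (Ha y Hy')), (is_pseries_unique _ _ _ (Hb y Hy')).
Qed.

Lemma taylor_eq (f : C -> C) (a : nat -> C) :
  is_taylor f a -> forall n, taylor f n = a n.
Proof.
intros Ha n.
assert (Ht : is_taylor f (taylor f)) by (unfold taylor; apply epsilon_spec; now exists a).
assert (D : forall x : R, (Rabs x < 1)%R -> disk (RtoC x)).
{ intros x Hx; unfold disk; now rewrite Cmod_R. }
apply injective_projections.
- apply (pseries_coef_unique (fun n => Re (taylor f n)) (fun n => Re (a n))
           (fun x => Re (f (RtoC x)))); intros x Hx;
  [apply (is_pseries_C_parts _ _ _ (Ht _ (D x Hx)))
  |apply (is_pseries_C_parts _ _ _ (Ha _ (D x Hx)))].
- apply (pseries_coef_unique (fun n => Im (taylor f n)) (fun n => Im (a n))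
           (fun x => Im (f (RtoC x)))); intros x Hx;
  [apply (is_pseries_C_parts _ _ _ (Ht _ (D x Hx)))
  |apply (is_pseries_C_parts _ _ _ (Ha _ (D x Hx)))].
Qed.

(* Main.v *)
Require Import Defs.
From Stdlib Require Import Reals Lra Lia Psatz FunctionalExtensionality.
From Coquelicot Require Import Coquelicot.
Open Scope C_scope.

(** A function [f] of H^2 is handled through its square-summable Taylor sequence
    [y], and [W f = psi * (f o phi)]. Put [c = b1 - |b0|^2], so that
    [phi z = (b0 + c z) / (1 - conj b0 z)].

    Boundedness is obtained in the way of Littlewood's subordination proof.
    Writing [B] for the backward shift, let
    [P = (conj b0 + c B) (1 - b0 B)^-1] ([littlewood]). One computes that
    [W f = b2 f(b0) + z W(P f)], so the [n]-th Taylor coefficient of [W f] is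
    [b2 (P^n f)(b0)]. If [x = (1 - b0 B)^-1 y], then [x 0 = f(b0)] and
    consecutive entries of [x] satisfy the telescoping inequality
    [littlewood_pointwise], which sums to
    [|P f|^2 + kappa |f(b0)|^2 <= |f|^2]; it holds for [-1 <= c <= 1 - 2|b0|],
    bounds that follow from [phi] mapping the diameter of the disk through [b0]
    into the disk ([self_map_bounds]). Iterating, [kappa] times the sum of the
    [|(P^n f)(b0)|^2] is at most [|f|^2]: hence [W] maps H^2 to H^2 with norm at
    most [|b2| / sqrt kappa].

    Self-adjointness is checked on the reproducing kernels
    [k_w(z) = 1 / (1 - conj w z)], for which [W k_w = conj (psi w) k_(phi w)]
    ([wc_kernel]); hence [<W f, k_w> = psi(w) f(phi w) = <f, W k_w>]. For fixed
    [f] the difference [<W f, g> - <f, W g>] is a bounded antilinear functional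
    of [g], and such a functional is zero as soon as it kills all kernels
    ([bounded_antilinear_eq_0]): its value at [k_w] is a power series in [w].

    Finally the conjugation is [K f (z) = conj (f (- lambda conj z))], and since
    [- lambda conj b0 = b0], the symmetry of [psi] and [phi] under
    [z |-> - lambda conj z] gives [K W = W K] pointwise ([wc_conj_J_rotate]). *)

(** * Series of complex numbers *)

Notation is_Cseries := (@is_series C_AbsRing C_NormedModule).

(** Unlike [sum_n], which has [n + 1] terms, [Csum u N] and [Rsum u N] have [N]
    terms, so that remainders start from the empty sum. *)
Fixpoint Csum (u : nat -> C) (N : nat) : C :=
  match N with O => 0 | S n => Csum u n + u n end.

Fixpoint Rsum (u : nat -> R) (N : nat) : R :=
  match N with O => 0 | S n => Rsum u n + u n end.

Lemma Csum_S_sum_n (u : nat -> C) (n : nat) :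
  Csum u (S n) = @sum_n C_AbelianMonoid u n.
Proof.
induction n as [|n IH].
- rewrite sum_O; simpl; ring.
- rewrite sum_Sn, <- IH; reflexivity.
Qed.

Lemma Rsum_S_sum_n (u : nat -> R) (n : nat) : Rsum u (S n) = sum_n u n.
Proof.
induction n as [|n IH].
- rewrite sum_O; simpl; ring.
- rewrite sum_Sn, <- IH; reflexivity.
Qed.

Lemma is_Cseries_Csum (u : nat -> C) (l : C) :
  is_Cseries u l <-> is_lim_seq (fun N => Cmod (Csum u N - l)) 0.
Proof.
split.
- intros H; apply is_lim_seq_incr_1.
  apply is_lim_seq_ext with (fun n => @norm C_AbsRing C_NormedModule
     (minus (@sum_n C_AbelianMonoid u n) l)).
  { intros n; now rewrite Csum_S_sum_n. }
  apply is_lim_seq_spec; intros eps.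
  assert (H' := proj1 (filterlim_locally_ball_norm _ _) H eps).
  revert H'; apply filter_imp; intros n Hn.
  rewrite Rminus_0_r, Rabs_pos_eq by apply norm_ge_0; exact Hn.
- intros H; apply filterlim_locally_ball_norm; intros eps.
  apply is_lim_seq_incr_1 in H; apply is_lim_seq_spec in H.
  generalize (H eps); apply filter_imp; intros n Hn.
  rewrite Rminus_0_r, Csum_S_sum_n, Rabs_pos_eq in Hn by apply Cmod_ge_0; exact Hn.
Qed.

Lemma is_series_Rsum (u : nat -> R) (l : R) :
  is_series u l <-> is_lim_seq (Rsum u) l.
Proof.
split.
- intros H; apply is_lim_seq_incr_1.
  apply is_lim_seq_ext with (2 := H); intros n; now rewrite Rsum_S_sum_n.
- intros H; apply is_lim_seq_incr_1 in H.
  apply is_lim_seq_ext with (2 := H); intros n; now rewrite Rsum_S_sum_n.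
Qed.

Lemma is_Cseries_unique (u : nat -> C) (l : C) : is_Cseries u l -> CSeries u = l.
Proof.
intros H; destruct (is_series_C_parts _ _ H) as [H1 H2].
apply injective_projections; simpl; now apply is_series_unique.
Qed.

Lemma is_Cseries_ext (u v : nat -> C) (l : C) :
  (forall n, u n = v n) -> is_Cseries u l -> is_Cseries v l.
Proof. exact (is_series_ext u v l). Qed.

Lemma is_Cseries_0 : is_Cseries (fun _ => RtoC 0) (RtoC 0).
Proof.
apply is_Cseries_Csum.
apply is_lim_seq_ext with (fun _ => 0%R); [|apply is_lim_seq_const].
intros N; replace (Csum (fun _ => 0) N - 0) with (RtoC 0); [now rewrite Cmod_0|].
induction N as [|N IH]; simpl; [ring|]; rewrite IH at 1; ring.
Qed.

Lemma is_Cseries_plus (u v : nat -> C) (l m : C) :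
  is_Cseries u l -> is_Cseries v m -> is_Cseries (fun n => u n + v n) (l + m).
Proof. exact (is_series_plus u v l m). Qed.

Lemma is_Cseries_scal (c : C) (u : nat -> C) (l : C) :
  is_Cseries u l -> is_Cseries (fun n => c * u n) (c * l).
Proof. exact (is_series_scal_l c u l). Qed.

Lemma is_Cseries_conj (u : nat -> C) (l : C) :
  is_Cseries u l -> is_Cseries (fun n => Cconj (u n)) (Cconj l).
Proof.
intros H; apply is_Cseries_Csum; apply is_Cseries_Csum in H.
apply is_lim_seq_ext with (2 := H); intros N.
rewrite <- Cmod_conj, Cminus_conj; do 2 f_equal.
induction N as [|N IH]; simpl.
- apply injective_projections; simpl; ring.
- now rewrite Cplus_conj, IH.
Qed.

Lemma Cconj_RtoC (x : R) : Cconj (RtoC x) = RtoC x.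
Proof. apply injective_projections; simpl; ring. Qed.

Lemma is_Cseries_tail (u : nat -> C) (l : C) :
  is_Cseries u l -> is_Cseries (fun n => u (S n)) (l - u 0%nat).
Proof.
intros H; apply is_series_incr_1.
refine (eq_ind l (is_Cseries u) H _ _).
change (l = l - u 0%nat + u 0%nat); ring.
Qed.

Lemma Rsum_le (u v : nat -> R) (N : nat) :
  (forall n, u n <= v n)%R -> (Rsum u N <= Rsum v N)%R.
Proof.
intros H; induction N as [|N IH]; simpl; [lra|]; specialize (H N); lra.
Qed.

Lemma Rsum_ge_0 (u : nat -> R) (N : nat) :
  (forall n, 0 <= u n)%R -> (0 <= Rsum u N)%R.
Proof.
intros H; induction N as [|N IH]; simpl; [lra|]; specialize (H N); lra.
Qed.

Lemma Rsum_le_Series (u : nat -> R) (N : nat) :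
  (forall n, 0 <= u n)%R -> ex_series u -> (Rsum u N <= Series u)%R.
Proof.
intros H0 H; apply Series_correct, is_series_Rsum in H.
apply (is_lim_seq_incr_compare (Rsum u)) with (1 := H).
intros n; simpl; specialize (H0 n); lra.
Qed.

Lemma Series_nonneg_le (u : nat -> R) (B : R) :
  (forall n, 0 <= u n)%R -> (forall N, Rsum u N <= B)%R ->
  ex_series u /\ (Series u <= B)%R.
Proof.
intros H0 HB.
assert (E : ex_finite_lim_seq (Rsum u)).
{ apply ex_finite_lim_seq_incr with B; [|exact HB].
  intros n; simpl; specialize (H0 n); lra. }
destruct E as [l Hl].
assert (Hs : is_series u l) by now apply is_series_Rsum.
split; [now exists l|].
rewrite (is_series_unique _ _ Hs).
exact (is_lim_seq_le _ _ l B HB Hl (is_lim_seq_const B)).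
Qed.

Lemma Series_nonneg (u : nat -> R) :
  (forall n, 0 <= u n)%R -> ex_series u -> (0 <= Series u)%R.
Proof. exact (Rsum_le_Series u 0). Qed.

Lemma Cmod_Csum_le (u : nat -> C) (N : nat) :
  (Cmod (Csum u N) <= Rsum (fun n => Cmod (u n)) N)%R.
Proof.
induction N as [|N IH]; simpl; [rewrite Cmod_0; lra|].
eapply Rle_trans; [apply Cmod_triangle|]; lra.
Qed.

Lemma is_Cseries_Cmod_le (u : nat -> C) (l : C) (B : R) :
  is_Cseries u l -> (forall N, Cmod (Csum u N) <= B)%R -> (Cmod l <= B)%R.
Proof.
intros H HB; apply is_Cseries_Csum in H.
assert (L : is_lim_seq (fun N => Cmod (Csum u N - l) + B)%R B).
{ replace (Finite B) with (Finite (0 + B)) by (f_equal; ring).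
  apply is_lim_seq_plus'; [exact H|apply is_lim_seq_const]. }
apply (fun A => is_lim_seq_le _ _ (Cmod l) B A (is_lim_seq_const _) L).
intros N; replace l with (- (Csum u N - l) + Csum u N) at 1 by ring.
eapply Rle_trans; [apply Cmod_triangle|].
rewrite Cmod_opp; specialize (HB N); lra.
Qed.

Lemma Cseries_dominated (u : nat -> C) (v : nat -> R) :
  (forall n, Cmod (u n) <= v n)%R -> ex_series v ->
  is_Cseries u (CSeries u) /\ (Cmod (CSeries u) <= Series v)%R.
Proof.
intros Huv Hv.
assert (E : is_Cseries u (CSeries u)).
{ destruct (@ex_series_le C_AbsRing C_CompleteNormedModule u v Huv Hv) as [l Hl].
  rewrite (is_Cseries_unique u l Hl); exact Hl. }
split; [exact E|].
apply (is_Cseries_Cmod_le _ _ _ E); intros N.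
eapply Rle_trans; [apply Cmod_Csum_le|].
eapply Rle_trans; [apply Rsum_le, Huv|].
apply Rsum_le_Series; [|exact Hv].
intros n; eapply Rle_trans; [apply Cmod_ge_0|apply Huv].
Qed.

(** * Square-summable sequences and the Hardy space *)

Lemma pow_n_Cpow (z : C) (n : nat) : @pow_n C_Ring z n = z ^ n.
Proof.
induction n as [|n IH]; [reflexivity|].
change (z * @pow_n C_Ring z n = z * z ^ n); now rewrite IH.
Qed.

Lemma is_taylor_Cseries (f : C -> C) (a : nat -> C) :
  is_taylor f a <-> forall z, disk z -> is_Cseries (fun n => a n * z ^ n) (f z).
Proof.
assert (E : forall z n, @scal C_AbsRing C_NormedModule (@pow_n C_AbsRing z n) (a n) = a n * z ^ n).
{ intros z n; change (@pow_n C_Ring z n * a n = a n * z ^ n).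
  rewrite pow_n_Cpow; ring. }
split; intros H z Hz.
- apply is_Cseries_ext with (2 := H z Hz); intros n; apply E.
- apply (is_Cseries_ext (fun n => a n * z ^ n)); [intros n; symmetry; apply E|now apply H].
Qed.

Definition l2 (a : nat -> C) : Prop := ex_series (fun n => (Cmod (a n) ^ 2)%R).

Definition l2sq (a : nat -> C) : R := Series (fun n => (Cmod (a n) ^ 2)%R).

Definition ev (a : nat -> C) (z : C) : C := CSeries (fun n => a n * z ^ n).

Lemma l2sq_ge_0 (a : nat -> C) : l2 a -> (0 <= l2sq a)%R.
Proof. apply Series_nonneg; intros n; apply pow2_ge_0. Qed.

Lemma l2_Cmod_le (a : nat -> C) (n : nat) : l2 a -> (Cmod (a n) <= sqrt (l2sq a))%R.
Proof.
intros Ha.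
assert (H := Rsum_le_Series _ (S n) (fun k => pow2_ge_0 (Cmod (a k))) Ha).
assert (H0 := Rsum_ge_0 _ n (fun k => pow2_ge_0 (Cmod (a k)))).
cbn [Rsum] in H; fold (l2sq a) in H.
rewrite <- (sqrt_pow2 (Cmod (a n))) by apply Cmod_ge_0.
apply sqrt_le_1_alt; lra.
Qed.

Lemma l2_tail (a : nat -> C) (N : nat) : l2 a ->
  l2 (fun k => a (N + k)%nat) /\
  l2sq (fun k => a (N + k)%nat) = (l2sq a - Rsum (fun n => (Cmod (a n) ^ 2)%R) N)%R.
Proof.
intros Ha; induction N as [|N [IH1 IH2]].
- split; [exact Ha|]; unfold l2sq; simpl; ring.
- assert (E : forall k, (N + S k = S N + k)%nat) by (intros; lia).
  split.
  + apply (ex_series_incr_1 (fun k => (Cmod (a (N + k)%nat) ^ 2)%R)) in IH1.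
    apply ex_series_ext with (2 := IH1); intros k; now rewrite E.
  + unfold l2sq in IH2 at 1; rewrite Series_incr_1 in IH2 by exact IH1.
    rewrite Nat.add_0_r in IH2; cbn [Rsum].
    replace (l2sq (fun k => a (S N + k)%nat)) with
      (Series (fun k => (Cmod (a (N + S k)%nat) ^ 2)%R)); [lra|].
    apply Series_ext; intros k; now rewrite E.
Qed.

Lemma l2sq_tail_lim (a : nat -> C) : l2 a ->
  is_lim_seq (fun N => sqrt (l2sq (fun k => a (N + k)%nat))) 0.
Proof.
intros Ha; rewrite <- sqrt_0.
apply (is_lim_seq_continuous sqrt (fun N => l2sq (fun k => a (N + k)%nat)) 0).
- apply continuity_pt_sqrt; lra.
- apply is_lim_seq_ext with (fun N => (l2sq a - Rsum (fun n => (Cmod (a n) ^ 2)%R) N)%R).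
  { intros N; symmetry; now apply l2_tail. }
  replace (Finite 0) with (Finite (l2sq a - l2sq a)) by (f_equal; ring).
  apply is_lim_seq_minus'; [apply is_lim_seq_const|].
  now apply is_series_Rsum, Series_correct.
Qed.

Lemma l2_lin (alpha beta : C) (a b : nat -> C) :
  l2 a -> l2 b -> l2 (fun n => alpha * a n + beta * b n).
Proof.
intros Ha Hb.
apply (@ex_series_le R_AbsRing R_CompleteNormedModule) with
  (fun n => (2 * Cmod alpha ^ 2 * Cmod (a n) ^ 2 + 2 * Cmod beta ^ 2 * Cmod (b n) ^ 2)%R).
- intros n; change norm with Rabs; rewrite Rabs_pos_eq by apply pow2_ge_0.
  assert (H := Cmod_triangle (alpha * a n) (beta * b n)).
  rewrite !Cmod_mult in H.
  apply (fun H0 => pow_incr _ _ 2 (conj (Cmod_ge_0 _) H0)) in H.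
  assert (H0 := pow2_ge_0 (Cmod alpha * Cmod (a n) - Cmod beta * Cmod (b n))).
  lra.
- apply (ex_series_plus (V := R_NormedModule));
    apply (ex_series_scal (V := R_NormedModule)); assumption.
Qed.

Lemma ev_bounded (a : nat -> C) (B : R) (z : C) :
  (forall n, Cmod (a n) <= B)%R -> disk z ->
  is_Cseries (fun n => a n * z ^ n) (ev a z) /\ (Cmod (ev a z) <= B / (1 - Cmod z))%R.
Proof.
intros HB Hz.
assert (Hz' : (Rabs (Cmod z) < 1)%R) by (rewrite Rabs_pos_eq; [exact Hz|apply Cmod_ge_0]).
assert (G : is_series (fun n => (B * Cmod z ^ n)%R) (B / (1 - Cmod z))%R).
{ exact (is_series_scal_l (V := R_NormedModule) B _ _ (is_series_geom _ Hz')). }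
rewrite <- (is_series_unique _ _ G).
apply Cseries_dominated; [|eexists; exact G].
intros n; rewrite Cmod_mult, Cmod_pow.
apply Rmult_le_compat_r; [apply pow_le, Cmod_ge_0|apply HB].
Qed.

Lemma ev_cons (a : nat -> C) (B : R) (z : C) :
  (forall n, Cmod (a n) <= B)%R -> disk z ->
  ev a z = a 0%nat + z * ev (fun n => a (S n)) z.
Proof.
intros HB Hz.
destruct (ev_bounded a B z HB Hz) as [H _].
destruct (ev_bounded (fun n => a (S n)) B z (fun n => HB (S n)) Hz) as [H1 _].
apply is_Cseries_tail in H; apply is_Cseries_unique in H.
apply (is_Cseries_scal z) in H1.
apply (is_Cseries_ext _ (fun n => a (S n) * z ^ S n)) in H1.
- apply is_Cseries_unique in H1; rewrite <- H1, H; simpl; ring.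
- intros n; simpl; ring.
Qed.

Lemma ev_lin (alpha beta : C) (a b : nat -> C) (A B : R) (z : C) :
  (forall n, Cmod (a n) <= A)%R -> (forall n, Cmod (b n) <= B)%R -> disk z ->
  ev (fun n => alpha * a n + beta * b n) z = alpha * ev a z + beta * ev b z.
Proof.
intros HA HB Hz; apply is_Cseries_unique.
apply (is_Cseries_ext (fun n => alpha * (a n * z ^ n) + beta * (b n * z ^ n))).
- intros n; ring.
- apply is_Cseries_plus; apply is_Cseries_scal;
    [apply (ev_bounded a A)|apply (ev_bounded b B)]; assumption.
Qed.

Lemma Rsum_Cauchy_Schwarz (u v : nat -> R) (N : nat) :
  (forall n, 0 <= u n)%R -> (forall n, 0 <= v n)%R ->
  (Rsum (fun n => u n * v n) N <=
   sqrt (Rsum (fun n => u n ^ 2) N) * sqrt (Rsum (fun n => v n ^ 2) N))%R.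
Proof.
intros Hu Hv.
rewrite <- sqrt_mult_alt by (apply Rsum_ge_0; intros n; apply pow2_ge_0).
rewrite <- (sqrt_pow2 (Rsum (fun n => (u n * v n)%R) N)).
2:{ apply Rsum_ge_0; intros n; now apply Rmult_le_pos. }
apply sqrt_le_1_alt.
assert (HA := fun N => Rsum_ge_0 (fun n => (u n ^ 2)%R) N (fun n => pow2_ge_0 (u n))).
assert (HB := fun N => Rsum_ge_0 (fun n => (v n ^ 2)%R) N (fun n => pow2_ge_0 (v n))).
assert (HS := fun N => Rsum_ge_0 (fun n => (u n * v n)%R) N (fun n => Rmult_le_pos _ _ (Hu n) (Hv n))).
induction N as [|N IH]; [simpl; lra|].
specialize (HA N); specialize (HB N); specialize (HS N); specialize (Hu N); specialize (Hv N).
cbn [Rsum].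
set (A := Rsum (fun n => u n ^ 2)%R N) in *; set (B := Rsum (fun n => v n ^ 2)%R N) in *.
set (s := Rsum (fun n => u n * v n)%R N) in *.
generalize dependent s; generalize dependent A; generalize dependent B.
generalize dependent (u N); generalize dependent (v N); clear; intros v Hv u Hu B HB A HA s HS IH.
(* AM-GM, as [s ^ 2 <= A * B]: the cross term of the square of the new sum. *)
assert (K : (2 * s * (u * v) <= A * v ^ 2 + B * u ^ 2)%R).
{ apply Rsqr_incr_0_var; [unfold Rsqr|].
  - assert (H := pow2_ge_0 (A * v ^ 2 - B * u ^ 2)).
    assert (H' := Rmult_le_compat_r _ _ _ (pow2_ge_0 (u * v)) IH); lra.
  - assert (H := Rmult_le_pos _ _ HA (pow2_ge_0 v)).
    assert (H' := Rmult_le_pos _ _ HB (pow2_ge_0 u)); lra. }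
lra.
Qed.

Lemma l2_inner (a b : nat -> C) : l2 a -> l2 b ->
  is_Cseries (fun n => a n * Cconj (b n)) (CSeries (fun n => a n * Cconj (b n))%C) /\
  (Cmod (CSeries (fun n => a n * Cconj (b n))%C) <= sqrt (l2sq a) * sqrt (l2sq b))%R.
Proof.
intros Ha Hb.
assert (E : is_Cseries (fun n => a n * Cconj (b n)) (CSeries (fun n => a n * Cconj (b n)))).
{ apply Cseries_dominated with (fun n => (Cmod (a n) ^ 2 + Cmod (b n) ^ 2)%R).
  - intros n; rewrite Cmod_mult, Cmod_conj.
    assert (H := pow2_ge_0 (Cmod (a n) - Cmod (b n))).
    assert (H1 := Cmod_ge_0 (a n)); assert (H2 := Cmod_ge_0 (b n)); nra.
  - now apply (ex_series_plus (V := R_NormedModule)). }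
split; [exact E|].
apply (is_Cseries_Cmod_le _ _ _ E); intros N.
eapply Rle_trans; [apply Cmod_Csum_le|].
eapply Rle_trans.
- apply Rsum_le with (v := fun n => (Cmod (a n) * Cmod (b n))%R).
  intros n; rewrite Cmod_mult, Cmod_conj; lra.
- eapply Rle_trans; [apply Rsum_Cauchy_Schwarz; intros; apply Cmod_ge_0|].
  apply Rmult_le_compat; try apply sqrt_pos;
    apply sqrt_le_1_alt, Rsum_le_Series; try assumption; intros; apply pow2_ge_0.
Qed.

(** [H2_taylor] and [H2_intro] are the dictionary between H^2 and l^2, through
    which everything below is proved on sequences. *)
Lemma H2_taylor (f : C -> C) : H2 f ->
  l2 (taylor f) /\ forall z, disk z -> is_Cseries (fun n => taylor f n * z ^ n) (f z).
Proof.
intros [a [Ha La]].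
replace (taylor f) with a by (apply functional_extensionality; intros n; symmetry; now apply taylor_eq).
split; [exact La|now apply is_taylor_Cseries].
Qed.

Lemma H2_intro (f : C -> C) (a : nat -> C) : l2 a ->
  (forall z, disk z -> is_Cseries (fun n => a n * z ^ n) (f z)) ->
  H2 f /\ taylor f = a.
Proof.
intros La Ha; apply is_taylor_Cseries in Ha; split.
- now exists a.
- apply functional_extensionality; now apply taylor_eq.
Qed.

Lemma H2_ev (f : C -> C) (z : C) : H2 f -> disk z -> f z = ev (taylor f) z.
Proof. intros Hf Hz; symmetry; apply is_Cseries_unique; now apply H2_taylor. Qed.

Lemma H2_lin (alpha beta : C) (f g : C -> C) : H2 f -> H2 g ->
  H2 (fun z => alpha * f z + beta * g z) /\
  taylor (fun z => alpha * f z + beta * g z) =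
    (fun n => alpha * taylor f n + beta * taylor g n).
Proof.
intros Hf Hg; destruct (H2_taylor f Hf) as [Lf Tf], (H2_taylor g Hg) as [Lg Tg].
apply H2_intro; [now apply l2_lin|].
intros z Hz.
apply (is_Cseries_ext (fun n => alpha * (taylor f n * z ^ n) + beta * (taylor g n * z ^ n))).
- intros n; ring.
- apply is_Cseries_plus; apply is_Cseries_scal; auto.
Qed.

Lemma H2norm_l2sq (f : C -> C) : H2norm f = sqrt (l2sq (taylor f)).
Proof.
unfold H2norm, H2inner, CSeries, l2sq; simpl Re; f_equal.
apply Series_ext; intros n; rewrite Cmod2_alt; unfold Re, Im; simpl; ring.
Qed.

Lemma H2inner_spec (f g : C -> C) : H2 f -> H2 g ->
  is_Cseries (fun n => taylor f n * Cconj (taylor g n)) (H2inner f g) /\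
  (Cmod (H2inner f g) <= H2norm f * H2norm g)%R.
Proof.
intros Hf Hg; rewrite !H2norm_l2sq; apply l2_inner; now apply H2_taylor.
Qed.

(** * Boundedness of the weighted composition operator *)

Definition phi (b0 : C) (b1 : R) (z : C) : C := b0 + RtoC b1 * z / (1 - Cconj b0 * z).

Definition psi (b0 : C) (b2 : R) (z : C) : C := RtoC b2 / (1 - Cconj b0 * z).

(** The sequence [(1 - b0 B)^-1 y], with [B] the backward shift; the Neumann
    series at index [n] is the [n]-th shift of [y] evaluated at [b0]. *)
Definition resolvent (b0 : C) (y : nat -> C) (n : nat) : C :=
  ev (fun k => y (n + k)%nat) b0.

(** The operator [P = (conj b0 + c B) (1 - b0 B)^-1], which is the adjoint of
    multiplication by [phi] when [c = b1 - |b0|^2]. *)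
Definition littlewood (b0 : C) (c : R) (y : nat -> C) (n : nat) : C :=
  Cconj b0 * resolvent b0 y n + RtoC c * resolvent b0 y (S n).

(** The weight of the telescoping terms in [littlewood_pointwise], chosen so that
    in the difference of its two sides [|u|^2] has coefficient [|b| (1 + c)]. *)
Definition kappa (b0 : C) (c : R) : R := (1 - Cmod b0 ^ 2 - Cmod b0 * (1 + c))%R.

Lemma resolvent_spec (b0 : C) (y : nat -> C) : disk b0 -> l2 y ->
  (forall n, resolvent b0 y n = y n + b0 * resolvent b0 y (S n)) /\
  is_lim_seq (fun n => Cmod (resolvent b0 y n)) 0.
Proof.
intros Hb Hy; split.
- intros n; unfold resolvent.
  rewrite (ev_cons _ (sqrt (l2sq y))), Nat.add_0_r;
    [|intros; now apply l2_Cmod_le|exact Hb].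
  do 3 f_equal; apply functional_extensionality; intros k; f_equal; lia.
- apply is_lim_seq_le_le with (u := fun _ => 0%R)
    (w := fun N => (sqrt (l2sq (fun k => y (N + k)%nat)) * / (1 - Cmod b0))%R).
  + intros N; split; [apply Cmod_ge_0|].
    apply (ev_bounded (fun k => y (N + k)%nat)); [|exact Hb].
    intros k; apply (l2_Cmod_le (fun k => y (N + k)%nat)); now apply l2_tail.
  + apply is_lim_seq_const.
  + replace (Finite 0) with (Rbar_mult 0 (/ (1 - Cmod b0))%R) by (simpl; f_equal; ring).
    apply (is_lim_seq_scal_r _ _ 0); now apply l2sq_tail_lim.
Qed.

Lemma resolvent_bounded (b0 : C) (y : nat -> C) (n : nat) : disk b0 -> l2 y ->
  (Cmod (resolvent b0 y n) <= sqrt (l2sq y) / (1 - Cmod b0))%R.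
Proof.
intros Hb Hy; apply (ev_bounded (fun k => y (n + k)%nat)); [|exact Hb].
intros k; now apply l2_Cmod_le.
Qed.

Lemma Cmod2_sub_mul (b u v : C) (c : R) :
  (Cmod (Cconj b * u + RtoC c * v) ^ 2 =
     Cmod b ^ 2 * Cmod u ^ 2 + c ^ 2 * Cmod v ^ 2 + 2 * c * Re (b * v * Cconj u))%R /\
  (Cmod (u - b * v) ^ 2 =
     Cmod u ^ 2 + Cmod b ^ 2 * Cmod v ^ 2 - 2 * Re (b * v * Cconj u))%R.
Proof.
rewrite !Cmod2_alt; destruct b, u, v; unfold Re, Im; simpl; split; ring.
Qed.

(** Here [u] and [v] are consecutive entries of the resolvent sequence. The
    right side minus the left side is
    [(1 + c) (|b| (|u|^2 + |v|^2) - 2 Re (b v conj u)) + (1 + c) (1 - c - 2|b|) |v|^2],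
    a sum of two nonnegative terms. *)
Lemma littlewood_pointwise (b u v : C) (c : R) :
  (-1 <= c <= 1 - 2 * Cmod b)%R ->
  (Cmod (Cconj b * u + RtoC c * v) ^ 2 + kappa b c * Cmod u ^ 2 <=
   Cmod (u - b * v) ^ 2 + kappa b c * Cmod v ^ 2)%R.
Proof.
intros Hc; destruct (Cmod2_sub_mul b u v c) as [-> ->]; unfold kappa.
assert (HX : (2 * Re (b * v * Cconj u) <= Cmod b * (Cmod u ^ 2 + Cmod v ^ 2))%R).
{ assert (H : (Re (b * v * Cconj u) <= Cmod b * Cmod v * Cmod u)%R).
  { eapply Rle_trans; [apply Rle_abs|].
    eapply Rle_trans; [apply re_le_Cmod|]; rewrite !Cmod_mult, Cmod_conj; lra. }
  assert (H' := Rmult_le_pos _ _ (Cmod_ge_0 b) (pow2_ge_0 (Cmod u - Cmod v))); lra. }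
assert (H1 : (0 <= (1 + c) * (Cmod b * (Cmod u ^ 2 + Cmod v ^ 2) - 2 * Re (b * v * Cconj u)))%R)
  by (apply Rmult_le_pos; lra).
assert (H2 : (0 <= (1 + c) * (1 - c - 2 * Cmod b) * Cmod v ^ 2)%R)
  by (apply Rmult_le_pos; [apply Rmult_le_pos; lra|apply pow2_ge_0]).
lra.
Qed.

(** At [c = 1 - 2|b|] the constant [kappa] equals [(1 - |b|)^2], and it is
    nonincreasing in [c]. *)
Lemma kappa_pos (b : C) (c : R) :
  disk b -> (c <= 1 - 2 * Cmod b)%R -> (0 < kappa b c)%R.
Proof.
unfold disk, kappa; intros Hb Hc.
assert (H := Rmult_le_compat_l _ _ _ (Cmod_ge_0 b) Hc).
assert (H' : (0 < (1 - Cmod b) * (1 - Cmod b))%R) by (apply Rmult_lt_0_compat; lra).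
lra.
Qed.

(** The sum of [littlewood_pointwise] over the entries of the resolvent: the
    boundary term at infinity vanishes, the one at [0] is [kappa |f(b0)|^2]. This
    gain is what controls the Taylor coefficients of [W f]. *)
Lemma littlewood_contraction (b0 : C) (c : R) (y : nat -> C) :
  disk b0 -> (-1 <= c <= 1 - 2 * Cmod b0)%R -> l2 y ->
  l2 (littlewood b0 c y) /\
  (l2sq (littlewood b0 c y) + kappa b0 c * Cmod (ev y b0) ^ 2 <= l2sq y)%R.
Proof.
intros Hb Hc Hy; destruct (resolvent_spec b0 y Hb Hy) as [Hx Hlim].
assert (K := kappa_pos b0 c Hb (proj2 Hc)).
set (k := kappa b0 c) in *; set (x := resolvent b0 y) in *.
assert (Hsum : forall N, (Rsum (fun n => Cmod (littlewood b0 c y n) ^ 2) N + k * Cmod (x 0%nat) ^ 2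
   <= Rsum (fun n => Cmod (y n) ^ 2) N + k * Cmod (x N) ^ 2)%R).
{ induction N as [|N IH]; [simpl; lra|]; cbn [Rsum].
  assert (H := littlewood_pointwise b0 (x N) (x (S N)) c Hc); fold k in H.
  replace (x N - b0 * x (S N)) with (y N) in H by (rewrite (Hx N); ring).
  unfold littlewood at 2; fold x; lra. }
assert (HB : forall N, (Rsum (fun n => Cmod (littlewood b0 c y n) ^ 2) N <=
    l2sq y - k * Cmod (x 0%nat) ^ 2)%R).
{ intros N.
  set (u := Rsum (fun n => Cmod (littlewood b0 c y n) ^ 2)%R).
  assert (L : is_lim_seq (fun M => l2sq y + k * Cmod (x M) ^ 2 - k * Cmod (x 0%nat) ^ 2)%R
                (l2sq y - k * Cmod (x 0%nat) ^ 2)%R).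
  { apply is_lim_seq_minus'; [|apply is_lim_seq_const].
    replace (Finite (l2sq y)) with (Finite (l2sq y + k * (0 * (0 * 1)))) by (f_equal; ring).
    apply is_lim_seq_plus'; [apply is_lim_seq_const|].
    apply is_lim_seq_mult'; [apply is_lim_seq_const|].
    apply is_lim_seq_mult'; [exact Hlim|].
    apply is_lim_seq_mult'; [exact Hlim|apply is_lim_seq_const]. }
  apply (is_lim_seq_le_loc (fun _ => u N) _ (u N) _) with (2 := is_lim_seq_const _) (3 := L).
  exists N; intros M HM.
  assert (Hmono : (u N <= u M)%R).
  { induction HM as [|M HM IH]; [lra|]; cbn [u Rsum].
    assert (H := pow2_ge_0 (Cmod (littlewood b0 c y M))).
    unfold u in *; cbn [Rsum]; lra. }
  assert (H := Rsum_le_Series _ M (fun n => pow2_ge_0 (Cmod (y n))) Hy).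
  specialize (Hsum M); fold (l2sq y) in H; unfold u in *; lra. }
destruct (Series_nonneg_le _ _ (fun n => pow2_ge_0 (Cmod (littlewood b0 c y n))) HB) as [H1 H2].
split; [exact H1|]; unfold l2sq at 1.
change (ev y b0) with (x 0%nat); lra.
Qed.

Lemma disk_denom (a z : C) : disk a -> disk z -> 1 - Cconj a * z <> 0.
Proof.
unfold disk; intros Ha Hz E.
assert (H : Cmod (Cconj a * z) = 1%R).
{ replace (Cconj a * z) with (RtoC 1) by (rewrite <- (Cplus_0_l (Cconj a * z)), <- E; ring).
  apply Cmod_1. }
rewrite Cmod_mult, Cmod_conj in H.
assert (H1 := Cmod_ge_0 a); assert (H2 := Cmod_ge_0 z); nra.
Qed.

Lemma Cconj_denom (a z : C) : Cconj (1 - Cconj a * z) = 1 - a * Cconj z.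
Proof. now rewrite Cminus_conj, Cmult_conj, Cconj_conj, Cconj_RtoC. Qed.

Lemma disk_denom_conj (a z : C) : disk a -> disk z -> 1 - a * Cconj z <> 0.
Proof.
intros Ha Hz E; apply (disk_denom a z Ha Hz).
now rewrite <- (Cconj_conj (1 - Cconj a * z)), Cconj_denom, E, Cconj_RtoC.
Qed.

(** With [x] the resolvent of [y], [x1] its shift and [w = phi z], the function
    [y] takes the value [x 0 + (w - b0) x1(w)] at [w] and [P y] takes the value
    [conj b0 (x 0) + (conj b0 w + c) x1(w)]; as [w - b0 = z (conj b0 w + c)], the
    claim is reduced to the identity [psi z (1 - conj b0 z) = b2]. *)
Lemma littlewood_step (b0 : C) (b1 b2 : R) (y : nat -> C) (z : C) :
  disk b0 -> l2 y -> disk z -> disk (phi b0 b1 z) ->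
  psi b0 b2 z * ev y (phi b0 b1 z) =
  RtoC b2 * ev y b0 +
  z * (psi b0 b2 z * ev (littlewood b0 (b1 - Cmod b0 ^ 2) y) (phi b0 b1 z)).
Proof.
intros Hb Hy Hz Hphi; destruct (resolvent_spec b0 y Hb Hy) as [Hx _].
assert (HB := fun n => resolvent_bounded b0 y n Hb Hy).
set (B := (sqrt (l2sq y) / (1 - Cmod b0))%R) in *.
change (ev y b0) with (resolvent b0 y 0).
set (x := resolvent b0 y) in *; set (w := phi b0 b1 z) in *.
set (x1 := fun n => x (S n)).
assert (E0 := ev_cons x B w HB Hphi); fold x1 in E0.
assert (E1 : ev y w = ev x w - b0 * ev x1 w).
{ transitivity (1 * ev x w + (- b0) * ev x1 w); [|ring].
  rewrite <- (ev_lin _ _ _ _ B B) by (auto; intros; apply HB).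
  f_equal; apply functional_extensionality; intros n; rewrite (Hx n); unfold x1; ring. }
unfold littlewood; fold x.
rewrite (ev_lin (Cconj b0) _ x x1 B B) by (auto; intros; apply HB).
rewrite E1, E0, RtoC_minus, Cmod2_conj; unfold w, phi, psi.
field; now apply disk_denom.
Qed.

(** The Taylor coefficients of [W f], read off by iterating [littlewood_step]. *)
Definition wc_coef (b0 : C) (b1 b2 : R) (y : nat -> C) (n : nat) : C :=
  RtoC b2 * ev (Nat.iter n (littlewood b0 (b1 - Cmod b0 ^ 2)) y) b0.

Lemma littlewood_iter (b0 : C) (c : R) (y : nat -> C) (N : nat) :
  disk b0 -> (-1 <= c <= 1 - 2 * Cmod b0)%R -> l2 y ->
  l2 (Nat.iter N (littlewood b0 c) y) /\
  (l2sq (Nat.iter N (littlewood b0 c) y) +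
   kappa b0 c * Rsum (fun n => Cmod (ev (Nat.iter n (littlewood b0 c) y) b0) ^ 2) N
   <= l2sq y)%R.
Proof.
intros Hb Hc Hy; induction N as [|N [IH1 IH2]]; cbn [Rsum Nat.iter nat_rect].
- split; [exact Hy|simpl; lra].
- destruct (littlewood_contraction b0 c _ Hb Hc IH1) as [H1 H2]; split; [exact H1|].
  unfold Nat.iter in *; lra.
Qed.

Lemma wc_coef_l2 (b0 : C) (b1 b2 : R) (y : nat -> C) :
  disk b0 -> (-1 <= b1 - Cmod b0 ^ 2 <= 1 - 2 * Cmod b0)%R -> l2 y ->
  l2 (wc_coef b0 b1 b2 y) /\
  (l2sq (wc_coef b0 b1 b2 y) <= b2 ^ 2 / kappa b0 (b1 - Cmod b0 ^ 2) * l2sq y)%R.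
Proof.
intros Hb Hc Hy; assert (K := kappa_pos _ _ Hb (proj2 Hc)).
set (c := (b1 - Cmod b0 ^ 2)%R) in *; set (k := kappa b0 c) in *.
apply Series_nonneg_le; [intros; apply pow2_ge_0|].
intros N; destruct (littlewood_iter b0 c y N Hb Hc Hy) as [H1 H2].
apply l2sq_ge_0 in H1; fold k in H2.
set (S := Rsum (fun n => Cmod (ev (Nat.iter n (littlewood b0 c) y) b0) ^ 2)%R N) in *.
replace (Rsum (fun n => Cmod (wc_coef b0 b1 b2 y n) ^ 2)%R N) with (b2 ^ 2 * S)%R.
- replace (b2 ^ 2 / k * l2sq y)%R with (b2 ^ 2 * (l2sq y / k))%R by (field; lra).
  apply Rmult_le_compat_l; [apply pow2_ge_0|].
  apply Rmult_le_reg_l with k; [exact K|].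
  replace (k * (l2sq y / k))%R with (l2sq y) by (field; lra); lra.
- unfold S; clear; induction N as [|N IH]; cbn [Rsum]; [ring|].
  rewrite <- IH; unfold wc_coef; fold c.
  rewrite Cmod_mult, Cmod_R, Rpow_mult_distr, pow2_abs; ring.
Qed.

(** After [N] steps the remainder is [z^N psi(z) (P^N f)(phi z)]; since [P] is a
    contraction the values [(P^N f)(phi z)] stay bounded, and the remainder tends
    to [0]. *)
Lemma wc_coef_Cseries (b0 : C) (b1 b2 : R) (y : nat -> C) (z : C) :
  disk b0 -> (-1 <= b1 - Cmod b0 ^ 2 <= 1 - 2 * Cmod b0)%R -> l2 y ->
  disk z -> disk (phi b0 b1 z) ->
  is_Cseries (fun n => wc_coef b0 b1 b2 y n * z ^ n)
    (psi b0 b2 z * ev y (phi b0 b1 z)).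
Proof.
intros Hb Hc Hy Hz Hphi.
set (c := (b1 - Cmod b0 ^ 2)%R) in *.
pose (p := fun N => Nat.iter N (littlewood b0 c) y).
assert (Hp : forall N, l2 (p N) /\ (l2sq (p N) <= l2sq y)%R).
{ intros N; destruct (littlewood_iter b0 c y N Hb Hc Hy) as [H1 H2]; split; [exact H1|].
  assert (K := kappa_pos _ _ Hb (proj2 Hc)).
  assert (H := Rsum_ge_0 _ N (fun n => pow2_ge_0 (Cmod (ev (p n) b0)))).
  assert (H' := Rmult_le_pos _ _ (Rlt_le _ _ K) H); unfold p in *; lra. }
assert (Hrem : forall N, Csum (fun n => wc_coef b0 b1 b2 y n * z ^ n) N
   - psi b0 b2 z * ev y (phi b0 b1 z)
   = - (z ^ N * (psi b0 b2 z * ev (p N) (phi b0 b1 z)))).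
{ induction N as [|N IH]; [simpl; ring|].
  replace (Csum (fun n => wc_coef b0 b1 b2 y n * z ^ n) (S N)
      - psi b0 b2 z * ev y (phi b0 b1 z)) with
    (Csum (fun n => wc_coef b0 b1 b2 y n * z ^ n) N
      - psi b0 b2 z * ev y (phi b0 b1 z) + wc_coef b0 b1 b2 y N * z ^ N)
    by (simpl; ring).
  rewrite IH, (littlewood_step b0 b1 b2 (p N) z Hb (proj1 (Hp N)) Hz Hphi).
  unfold wc_coef; fold c; change (p (S N)) with (littlewood b0 c (p N)).
  change (Nat.iter N (littlewood b0 c) y) with (p N).
  rewrite Cpow_S; fold c; ring. }
apply is_Cseries_Csum.
set (B := (Cmod (psi b0 b2 z) * (sqrt (l2sq y) / (1 - Cmod (phi b0 b1 z))))%R).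
apply is_lim_seq_le_le with (u := fun _ => 0%R) (w := fun N => (Cmod z ^ N * B)%R).
- intros N; split; [apply Cmod_ge_0|].
  rewrite Hrem, Cmod_opp, !Cmod_mult, Cmod_pow.
  apply Rmult_le_compat_l; [apply pow_le, Cmod_ge_0|].
  apply Rmult_le_compat_l; [apply Cmod_ge_0|].
  apply ev_bounded; [|exact Hphi]; intros n.
  eapply Rle_trans; [apply l2_Cmod_le, Hp|apply sqrt_le_1_alt, Hp].
- apply is_lim_seq_const.
- replace (Finite 0) with (Rbar_mult 0 B) by (simpl; f_equal; ring).
  apply (is_lim_seq_scal_r _ _ 0), is_lim_seq_geom.
  rewrite Rabs_pos_eq; [exact Hz|apply Cmod_ge_0].
Qed.

(** On the diameter through [b0 = r u] with [|u| = 1], the map is real: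
    [phi (t u) = u (r + c t) / (1 - r t)]. Letting [t] approach [1] and [-1] would
    give the two bounds; when one of them fails, the explicit [t] at which
    [r + c t] leaves the allowed interval is a contradiction. *)
Lemma self_map_bounds (b0 : C) (b1 : R) : disk b0 ->
  (forall z, disk z -> disk (phi b0 b1 z)) ->
  (-1 <= b1 - Cmod b0 ^ 2 <= 1 - 2 * Cmod b0)%R.
Proof.
intros Hb Hphi; set (r := Cmod b0) in *; set (c := (b1 - r ^ 2)%R).
assert (Hr : (0 <= r < 1)%R) by (split; [apply Cmod_ge_0|exact Hb]).
assert (Hu : exists u : C, Cmod u = 1%R /\ b0 = RtoC r * u).
{ destruct (Req_dec r 0) as [E|E].
  - exists 1; split; [apply Cmod_1|]; rewrite E; apply Cmod_eq_0 in E; rewrite E; ring.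
  - assert (E' : RtoC r <> 0) by (intros E'; apply E; now apply RtoC_inj).
    exists (b0 / RtoC r); split; [|field; exact E'].
    rewrite Cmod_div, Cmod_R, Rabs_pos_eq by (exact E' || apply Hr); fold r.
    field; exact E. }
destruct Hu as [u [Hu1 Hu2]].
assert (Huu : u * Cconj u = 1) by (now rewrite <- Cmod2_conj, Hu1, pow1).
assert (Hline : forall t : R, (Rabs t < 1)%R -> (Rabs (r + c * t) < 1 - r * t)%R).
{ intros t Ht.
  assert (Hpos : (0 < 1 - r * t)%R).
  { apply Rabs_def2 in Ht; nra. }
  assert (Hd : disk (RtoC t * u)) by (unfold disk; now rewrite Cmod_mult, Hu1, Cmod_R, Rmult_1_r).
  assert (E : phi b0 b1 (RtoC t * u) = RtoC ((r + c * t) / (1 - r * t)) * u).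
  { assert (E1 : Cconj b0 * (RtoC t * u) = RtoC (r * t)).
    { rewrite Hu2, Cmult_conj.
      rewrite Cconj_RtoC.
      replace (RtoC r * Cconj u * (RtoC t * u)) with (RtoC r * RtoC t * (u * Cconj u)) by ring.
      rewrite Huu, RtoC_mult; ring. }
    unfold phi; rewrite E1, Hu2 at 1.
    assert (Hn : 1 - RtoC (r * t) <> 0).
    { rewrite <- RtoC_minus; intros E2; apply RtoC_inj in E2; lra. }
    unfold c; rewrite RtoC_div by lra.
    repeat rewrite ?RtoC_plus, ?RtoC_minus, ?RtoC_mult, ?RtoC_pow.
    rewrite RtoC_mult in Hn; field; exact Hn. }
  specialize (Hphi _ Hd); unfold disk in Hphi.
  rewrite E, Cmod_mult, Hu1, Cmod_R, Rmult_1_r, Rabs_div, (Rabs_pos_eq (1 - r * t)) in Hphi by lra.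
  apply (Rmult_lt_compat_r (1 - r * t)) in Hphi; [|exact Hpos].
  replace (Rabs (r + c * t) / (1 - r * t) * (1 - r * t))%R with (Rabs (r + c * t)) in Hphi
    by (field; lra); lra. }
split.
- destruct (Rle_lt_dec (-1) c) as [H|H]; [exact H|exfalso].
  assert (Ht : (Rabs (- ((1 - r) / (- c - r))) < 1)%R).
  { rewrite Rabs_Ropp, Rabs_pos_eq.
    - apply Rmult_lt_reg_r with (- c - r)%R; [lra|].
      replace ((1 - r) / (- c - r) * (- c - r))%R with (1 - r)%R by (field; lra); lra.
    - apply Rlt_le, Rdiv_lt_0_compat; lra. }
  apply Hline in Ht; apply Rabs_def2 in Ht.
  set (s := ((1 - r) / (- c - r))%R) in *.
  assert (Es : (s * (- c - r) = 1 - r)%R) by (unfold s; field; lra); lra.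
- destruct (Rle_lt_dec c (1 - 2 * r)) as [H|H]; [exact H|exfalso].
  assert (Ht : (Rabs ((1 - r) / (c + r)) < 1)%R).
  { rewrite Rabs_pos_eq.
    - apply Rmult_lt_reg_r with (c + r)%R; [lra|].
      replace ((1 - r) / (c + r) * (c + r))%R with (1 - r)%R by (field; lra); lra.
    - apply Rlt_le, Rdiv_lt_0_compat; lra. }
  apply Hline in Ht; apply Rabs_def2 in Ht.
  set (s := ((1 - r) / (c + r))%R) in *.
  assert (Es : (s * (c + r) = 1 - r)%R) by (unfold s; field; lra); lra.
Qed.

Lemma wc_bounded (b0 : C) (b1 b2 : R) : disk b0 ->
  (forall z, disk z -> disk (phi b0 b1 z)) ->
  bounded_operator (weighted_comp (psi b0 b2) (phi b0 b1)).
Proof.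
intros Hb Hphi; assert (Hc := self_map_bounds b0 b1 Hb Hphi).
assert (HW : forall f, H2 f -> H2 (weighted_comp (psi b0 b2) (phi b0 b1) f) /\
   taylor (weighted_comp (psi b0 b2) (phi b0 b1) f) = wc_coef b0 b1 b2 (taylor f)).
{ intros f Hf; destruct (H2_taylor f Hf) as [Lf _].
  apply H2_intro; [now apply wc_coef_l2|].
  intros z Hz; unfold weighted_comp; rewrite (H2_ev f) by auto.
  apply wc_coef_Cseries; auto. }
split; [split|split].
- intros f Hf; now apply HW.
- intros f g _ _ Hfg z Hz; unfold weighted_comp; now rewrite Hfg by auto.
- intros alpha beta f g _ _ z _; unfold weighted_comp; ring.
- exists (sqrt (b2 ^ 2 / kappa b0 (b1 - Cmod b0 ^ 2))); intros f Hf.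
  destruct (H2_taylor f Hf) as [Lf _].
  rewrite !H2norm_l2sq, (proj2 (HW f Hf)), <- sqrt_mult_alt.
  + apply sqrt_le_1_alt; now apply wc_coef_l2.
  + apply Rdiv_le_0_compat; [apply pow2_ge_0|now apply kappa_pos].
Qed.

(** * Reproducing kernels and self-adjointness *)

Definition monomial (n : nat) (z : C) : C := z ^ n.

Definition kernel (w z : C) : C := / (1 - Cconj w * z).

Lemma taylor_ext (f g : C -> C) : H2 f -> eq_disk f g -> H2 g /\ taylor f = taylor g.
Proof.
intros Hf Hfg; destruct (H2_taylor f Hf) as [Lf Tf].
destruct (H2_intro g (taylor f) Lf) as [H1 H2]; [|now split].
intros z Hz; rewrite <- (Hfg z Hz); now apply Tf.
Qed.

Lemma H2_monomial (n : nat) :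
  H2 (monomial n) /\ taylor (monomial n) = (fun k => if Nat.eqb k n then 1 else 0).
Proof.
apply H2_intro.
- assert (E : forall N, Rsum (fun k => Cmod (if Nat.eqb k n then 1 else 0) ^ 2)%R N =
     (if Nat.ltb n N then 1 else 0)%R).
  { induction N as [|N IH]; [reflexivity|]; cbn [Rsum]; rewrite IH.
    destruct (Nat.eqb_spec N n), (Nat.ltb_spec n N), (Nat.ltb_spec n (S N)); try lia;
      rewrite ?Cmod_1, ?Cmod_0; ring. }
  apply (Series_nonneg_le _ 1); [intros; apply pow2_ge_0|].
  intros N; rewrite E; destruct (Nat.ltb n N); lra.
- intros z _.
  assert (E : forall N, Csum (fun k => (if Nat.eqb k n then 1 else 0) * z ^ k) N =
     if Nat.ltb n N then z ^ n else 0).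
  { induction N as [|N IH]; [reflexivity|]; cbn [Csum]; rewrite IH.
    destruct (Nat.eqb_spec N n), (Nat.ltb_spec n N), (Nat.ltb_spec n (S N)); try lia;
      subst; ring. }
  apply is_Cseries_Csum.
  apply is_lim_seq_ext_loc with (fun _ => 0%R); [|apply is_lim_seq_const].
  exists (S n); intros N HN; rewrite E; unfold monomial.
  destruct (Nat.ltb_spec n N); [|lia].
  replace (z ^ n - z ^ n) with (RtoC 0) by ring; now rewrite Cmod_0.
Qed.

Lemma H2_kernel (w : C) : disk w ->
  H2 (kernel w) /\ taylor (kernel w) = (fun n => Cconj w ^ n).
Proof.
intros Hw; apply H2_intro.
- assert (H : (Rabs (Cmod w ^ 2) < 1)%R).
  { rewrite Rabs_pos_eq by apply pow2_ge_0; unfold disk in Hw.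
    assert (H := Cmod_ge_0 w); nra. }
  eexists; apply is_series_ext with (2 := is_series_geom _ H).
  intros n; rewrite Cmod_pow, Cmod_conj, <- !pow_mult; f_equal; lia.
- intros z Hz; assert (Hd := disk_denom w z Hw Hz).
  unfold kernel; set (q := Cconj w * z) in *.
  assert (Hq : (Cmod q < 1)%R).
  { unfold q; rewrite Cmod_mult, Cmod_conj; unfold disk in *.
    assert (H := Cmod_ge_0 w); assert (H' := Cmod_ge_0 z); nra. }
  apply (is_Cseries_ext (fun n => q ^ n)).
  { intros n; unfold q; apply Cpow_mult_l. }
  apply is_Cseries_Csum.
  assert (E : forall N, Csum (fun n => q ^ n) N - / (1 - q) = - (q ^ N * / (1 - q))).
  { induction N as [|N IH]; [simpl; ring|]; cbn [Csum].
    replace (Csum (fun n => q ^ n) N + q ^ N - / (1 - q)) with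
      (Csum (fun n => q ^ n) N - / (1 - q) + q ^ N) by ring.
    rewrite IH, Cpow_S; field; exact Hd. }
  apply is_lim_seq_ext with (fun N => (Cmod q ^ N * Cmod (/ (1 - q)))%R).
  { intros N; now rewrite E, Cmod_opp, Cmod_mult, Cmod_pow. }
  replace (Finite 0) with (Rbar_mult 0 (Cmod (/ (1 - q)))) by (simpl; f_equal; ring).
  apply (is_lim_seq_scal_r _ _ 0), is_lim_seq_geom.
  rewrite Rabs_pos_eq; [exact Hq|apply Cmod_ge_0].
Qed.

Lemma H2inner_kernel (f : C -> C) (w : C) : H2 f -> disk w ->
  H2inner f (kernel w) = f w.
Proof.
intros Hf Hw; destruct (H2_kernel w Hw) as [_ E].
apply is_Cseries_unique; rewrite E.
apply is_Cseries_ext with (2 := proj2 (H2_taylor f Hf) w Hw).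
intros n; now rewrite Cpow_conj, Cconj_conj.
Qed.

Lemma H2inner_antilinear (f g h : C -> C) (alpha beta : C) : H2 f -> H2 g -> H2 h ->
  H2inner f (fun z => alpha * g z + beta * h z) =
  Cconj alpha * H2inner f g + Cconj beta * H2inner f h.
Proof.
intros Hf Hg Hh; destruct (H2_lin alpha beta g h Hg Hh) as [_ E].
apply is_Cseries_unique; rewrite E.
apply (is_Cseries_ext (fun n => Cconj alpha * (taylor f n * Cconj (taylor g n))
   + Cconj beta * (taylor f n * Cconj (taylor h n)))).
- intros n; rewrite Cplus_conj, !Cmult_conj; ring.
- apply is_Cseries_plus; apply is_Cseries_scal; now apply H2inner_spec.
Qed.

(** The Taylor remainder of [g], built by linear combinations of two functions so
    that linearity of a functional applies to it step by step. *)
Fixpoint remainder (g : C -> C) (N : nat) : C -> C :=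
  match N with
  | O => g
  | S n => fun z => 1 * remainder g n z + (- taylor g n) * monomial n z
  end.

Lemma H2_remainder (g : C -> C) (N : nat) : H2 g ->
  H2 (remainder g N) /\
  taylor (remainder g N) = (fun n => if Nat.ltb n N then 0 else taylor g n).
Proof.
intros Hg; induction N as [|N [IH1 IH2]]; [now split|].
destruct (H2_monomial N) as [M1 M2].
destruct (H2_lin 1 (- taylor g N) _ _ IH1 M1) as [H1 H2].
split; [exact H1|]; simpl remainder; rewrite H2, IH2, M2.
apply functional_extensionality; intros n.
destruct (Nat.eqb_spec n N), (Nat.ltb_spec n N), (Nat.ltb_spec n (S N)); try lia;
  subst; ring.
Qed.

Lemma H2norm_remainder_lim (g : C -> C) : H2 g ->
  is_lim_seq (fun N => H2norm (remainder g N)) 0.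
Proof.
intros Hg; destruct (H2_taylor g Hg) as [Lg _].
apply is_lim_seq_ext with (2 := l2sq_tail_lim _ Lg); intros N.
destruct (H2_remainder g N Hg) as [H1 H2].
rewrite H2norm_l2sq; f_equal.
assert (E := proj2 (l2_tail _ N (proj1 (H2_taylor _ H1)))).
assert (E1 : Rsum (fun n => Cmod (taylor (remainder g N) n) ^ 2)%R N = 0%R).
{ rewrite H2.
  assert (G : forall M, (M <= N)%nat -> Rsum (fun n => Cmod (if Nat.ltb n N then 0 else taylor g n) ^ 2)%R M = 0%R).
  { induction M as [|M IH]; [reflexivity|]; intros HM; cbn [Rsum].
    rewrite IH by lia; destruct (Nat.ltb_spec M N); [|lia]; rewrite Cmod_0; ring. }
  now apply G. }
rewrite E1, Rminus_0_r in E; rewrite <- E; f_equal.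
apply functional_extensionality; intros k; rewrite H2.
destruct (Nat.ltb_spec (N + k) N); [lia|reflexivity].
Qed.

Definition bounded_antilinear (F : (C -> C) -> C) : Prop :=
  (forall (alpha beta : C) f g, H2 f -> H2 g ->
     F (fun z => alpha * f z + beta * g z) = Cconj alpha * F f + Cconj beta * F g) /\
  (exists K : R, forall f, H2 f -> (Cmod (F f) <= K * H2norm f)%R).

(** [F] of the Taylor remainders of [g] tends to [0], because their norms do. *)
Lemma bounded_antilinear_Cseries (F : (C -> C) -> C) (g : C -> C) :
  bounded_antilinear F -> H2 g ->
  is_Cseries (fun n => Cconj (taylor g n) * F (monomial n)) (F g).
Proof.
intros [Flin [K FK]] Hg; apply is_Cseries_Csum.
assert (E : forall N, Csum (fun n => Cconj (taylor g n) * F (monomial n)) N - F g =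
   - F (remainder g N)).
{ induction N as [|N IH]; [simpl; ring|]; simpl remainder.
  rewrite Flin by (apply H2_remainder || apply H2_monomial; exact Hg).
  cbn [Csum]; rewrite Copp_conj, Cconj_RtoC.
  replace (F (remainder g N)) with (- - F (remainder g N)) by ring.
  rewrite <- IH; ring. }
apply is_lim_seq_le_le with (u := fun _ => 0%R) (w := fun N => (K * H2norm (remainder g N))%R).
- intros N; split; [apply Cmod_ge_0|].
  rewrite E, Cmod_opp; apply FK; now apply H2_remainder.
- apply is_lim_seq_const.
- replace (Finite 0) with (Rbar_mult K 0) by (simpl; f_equal; ring).
  apply (is_lim_seq_scal_l _ K 0); now apply H2norm_remainder_lim.
Qed.

(** The kernels are total in H^2. The kernel at [w] has Taylor sequence
    [(conj w)^n], so [F] maps it to the power series in [w] with coefficients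
    [F (z^n)]. A power series that vanishes on the disk has zero coefficients, so
    [F] kills the monomials, and then everything. *)
Lemma bounded_antilinear_eq_0 (F : (C -> C) -> C) :
  bounded_antilinear F -> (forall w, disk w -> F (kernel w) = 0) ->
  forall g, H2 g -> F g = 0.
Proof.
intros HF Hker g Hg.
assert (Hmon : forall n, F (monomial n) = 0).
{ assert (T1 : is_taylor (fun _ => 0) (fun n => F (monomial n))).
  { apply is_taylor_Cseries; intros w Hw; destruct (H2_kernel w Hw) as [Hk Tk].
    rewrite <- (Hker w Hw).
    apply is_Cseries_ext with (2 := bounded_antilinear_Cseries F _ HF Hk).
    intros n; rewrite Tk, Cpow_conj, Cconj_conj; ring. }
  assert (T2 : is_taylor (fun _ => 0) (fun _ => 0)).
  { apply is_taylor_Cseries; intros w _.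
    apply is_Cseries_ext with (2 := is_Cseries_0); intros n; ring. }
  intros n; rewrite <- (taylor_eq _ _ T1 n); exact (taylor_eq _ _ T2 n). }
rewrite <- (is_Cseries_unique _ _ (bounded_antilinear_Cseries F g HF Hg)).
apply is_Cseries_unique; apply is_Cseries_ext with (2 := is_Cseries_0).
intros n; rewrite Hmon; ring.
Qed.

(** The source of self-adjointness: [b2] is real, and the denominator of
    [W k_w (z)] is unchanged when [z] and [w] are swapped and all is conjugated,
    because [b1] is real. *)
Lemma wc_kernel (b0 : C) (b1 b2 : R) (w z : C) :
  disk b0 -> disk w -> disk z -> disk (phi b0 b1 w) -> disk (phi b0 b1 z) ->
  weighted_comp (psi b0 b2) (phi b0 b1) (kernel w) z =
  Cconj (psi b0 b2 w) * kernel (phi b0 b1 w) z.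
Proof.
intros Hb Hw Hz Hpw Hpz.
assert (D1 := disk_denom _ _ Hb Hz); assert (D2 := disk_denom _ _ Hb Hw).
assert (D3 := disk_denom _ _ Hw Hpz); assert (D4 := disk_denom _ _ Hpw Hz).
assert (D5 := disk_denom_conj _ _ Hb Hw).
assert (Ephi : Cconj (phi b0 b1 w) = Cconj b0 + RtoC b1 * Cconj w / (1 - b0 * Cconj w)).
{ unfold phi; rewrite Cplus_conj, Cdiv_conj, Cmult_conj, Cconj_denom, Cconj_RtoC by exact D2; reflexivity. }
unfold weighted_comp, psi, kernel; rewrite Cdiv_conj, Cconj_denom, Cconj_RtoC by exact D2.
(* Both denominators equal 1 - conj b0 z - b0 conj w - (b1 - |b0|^2) z conj w. *)
assert (E : (1 - Cconj b0 * z) * (1 - Cconj w * phi b0 b1 z) =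
            (1 - b0 * Cconj w) * (1 - Cconj (phi b0 b1 w) * z)).
{ rewrite Ephi; unfold phi; field; now split. }
transitivity (RtoC b2 * / ((1 - Cconj b0 * z) * (1 - Cconj w * phi b0 b1 z)));
  [field; now split|].
rewrite E; field; now split.
Qed.

Lemma wc_hermitian (b0 : C) (b1 b2 : R) : disk b0 ->
  (forall z, disk z -> disk (phi b0 b1 z)) ->
  hermitian (weighted_comp (psi b0 b2) (phi b0 b1)).
Proof.
intros Hb Hphi; assert (HW := wc_bounded b0 b1 b2 Hb Hphi).
split; [exact HW|]; destruct HW as [[HW2 _] [_ [M HM]]].
set (W := weighted_comp (psi b0 b2) (phi b0 b1)) in *.
intros f g Hf Hg.
set (F := fun h => H2inner (W f) h - H2inner f (W h)).
cut (F g = 0).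
{ unfold F; intros E; replace (H2inner (W f) g) with
    (H2inner (W f) g - H2inner f (W g) + H2inner f (W g)) by ring.
  rewrite E; ring. }
apply bounded_antilinear_eq_0; [split| |exact Hg]; unfold F.
- intros alpha beta h k Hh Hk.
  replace (W (fun z => alpha * h z + beta * k z)) with (fun z => alpha * W h z + beta * W k z)
    by (apply functional_extensionality; intros z; unfold W, weighted_comp; ring).
  rewrite !H2inner_antilinear by auto; ring.
- exists (H2norm (W f) + H2norm f * M)%R; intros h Hh.
  destruct (H2inner_spec (W f) h (HW2 f Hf) Hh) as [_ I1].
  destruct (H2inner_spec f (W h) Hf (HW2 h Hh)) as [_ I2].
  assert (I3 := Cmod_triangle (H2inner (W f) h) (- H2inner f (W h))).
  rewrite Cmod_opp in I3.
  assert (I4 : (H2norm f * H2norm (W h) <= H2norm f * (M * H2norm h))%R)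
    by (apply Rmult_le_compat_l; [apply sqrt_pos|now apply HM]).
  unfold Cminus; lra.
- intros w Hw; destruct (H2_kernel w Hw) as [Hk _].
  destruct (H2_kernel _ (Hphi w Hw)) as [Hk' _].
  rewrite H2inner_kernel by auto.
  replace (H2inner f (W (kernel w))) with
    (H2inner f (fun z => Cconj (psi b0 b2 w) * kernel (phi b0 b1 w) z
                         + 0 * kernel (phi b0 b1 w) z)).
  + rewrite H2inner_antilinear, H2inner_kernel, Cconj_conj by auto.
    rewrite Cconj_RtoC; unfold W, weighted_comp; ring.
  + unfold H2inner; f_equal.
    replace (taylor (W (kernel w))) with
      (taylor (fun z => Cconj (psi b0 b2 w) * kernel (phi b0 b1 w) z
                        + 0 * kernel (phi b0 b1 w) z)); [reflexivity|].
    symmetry; apply taylor_ext; [now apply HW2|].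
    intros z Hz; unfold W; rewrite wc_kernel by auto; ring.
Qed.

(** * The conjugation and the complex symmetry *)

Lemma disk_conj (z : C) : disk z -> disk (Cconj z).
Proof. unfold disk; now rewrite Cmod_conj. Qed.

Lemma disk_rotate (mu z : C) : Cmod mu = 1%R -> disk z -> disk (mu * z).
Proof. unfold disk; intros Hmu Hz; rewrite Cmod_mult, Hmu; lra. Qed.

Lemma H2_conj_J (f : C -> C) : H2 f ->
  H2 (conj_J f) /\ taylor (conj_J f) = (fun n => Cconj (taylor f n)) /\
  forall z, disk z -> conj_J f z = Cconj (f (Cconj z)).
Proof.
intros Hf; destruct (H2_taylor f Hf) as [Lf Tf].
assert (S : forall z, disk z ->
  is_Cseries (fun n => Cconj (taylor f n) * z ^ n) (Cconj (f (Cconj z)))).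
{ intros z Hz.
  apply is_Cseries_ext with (2 := is_Cseries_conj _ _ (Tf _ (disk_conj z Hz))).
  intros n; now rewrite Cmult_conj, Cpow_conj, Cconj_conj. }
assert (E : forall z, disk z -> conj_J f z = Cconj (f (Cconj z)))
  by (intros z Hz; apply is_Cseries_unique, S, Hz).
destruct (H2_intro (conj_J f) (fun n => Cconj (taylor f n))) as [H1 H2].
- apply ex_series_ext with (2 := Lf); intros n; now rewrite Cmod_conj.
- intros z Hz; rewrite E by exact Hz; now apply S.
- now split.
Qed.

Lemma H2_rotate (mu : C) (f : C -> C) : Cmod mu = 1%R -> H2 f ->
  H2 (comp_op (fun z => mu * z) f) /\
  taylor (comp_op (fun z => mu * z) f) = (fun n => mu ^ n * taylor f n).
Proof.
intros Hmu Hf; destruct (H2_taylor f Hf) as [Lf Tf]; apply H2_intro.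
- apply ex_series_ext with (2 := Lf); intros n.
  now rewrite Cmod_mult, Cmod_pow, Hmu, pow1, Rmult_1_l.
- intros z Hz; unfold comp_op, weighted_comp; rewrite Cmult_1_l.
  apply is_Cseries_ext with (2 := Tf _ (disk_rotate mu z Hmu Hz)).
  intros n; rewrite Cpow_mult_l; ring.
Qed.

Lemma conj_J_rotate (mu : C) (f : C -> C) : Cmod mu = 1%R -> H2 f ->
  H2 (conj_J (comp_op (fun z => mu * z) f)) /\
  H2norm (conj_J (comp_op (fun z => mu * z) f)) = H2norm f /\
  forall z, disk z ->
    conj_J (comp_op (fun z => mu * z) f) z = Cconj (f (mu * Cconj z)).
Proof.
intros Hmu Hf; destruct (H2_rotate mu f Hmu Hf) as [H1 T1].
destruct (H2_conj_J _ H1) as [H2 [T2 E]]; split; [exact H2|split].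
- rewrite !H2norm_l2sq, T2, T1; f_equal; apply Series_ext; intros n.
  now rewrite Cmod_conj, Cmod_mult, Cmod_pow, Hmu, pow1, Rmult_1_l.
- intros z Hz; rewrite E by exact Hz; unfold comp_op, weighted_comp.
  now rewrite Cmult_1_l.
Qed.

Lemma conjugation_conj_J_rotate (mu : C) : Cmod mu = 1%R ->
  conjugation (fun f => conj_J (comp_op (fun z => mu * z) f)).
Proof.
intros Hmu; split; [split|split; [|split]].
- intros f Hf; now apply conj_J_rotate.
- intros f g Hf Hg Hfg z Hz.
  destruct (conj_J_rotate mu f Hmu Hf) as [_ [_ ->]]; [|exact Hz].
  destruct (conj_J_rotate mu g Hmu Hg) as [_ [_ ->]]; [|exact Hz].
  now rewrite Hfg by (apply disk_rotate, disk_conj; assumption).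
- intros alpha beta f g Hf Hg z Hz.
  destruct (conj_J_rotate mu _ Hmu (proj1 (H2_lin alpha beta f g Hf Hg))) as [_ [_ ->]]; [|exact Hz].
  destruct (conj_J_rotate mu f Hmu Hf) as [_ [_ ->]]; [|exact Hz].
  destruct (conj_J_rotate mu g Hmu Hg) as [_ [_ ->]]; [|exact Hz].
  now rewrite Cplus_conj, !Cmult_conj.
- intros f Hf; now apply conj_J_rotate.
- intros f Hf z Hz; destruct (conj_J_rotate mu f Hmu Hf) as [H1 [_ E]].
  destruct (conj_J_rotate mu _ Hmu H1) as [_ [_ ->]]; [|exact Hz].
  rewrite E by (apply disk_rotate, disk_conj; assumption).
  rewrite Cconj_conj, Cmult_conj, Cconj_conj; f_equal.
  transitivity (mu * Cconj mu * z); [ring|].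
  rewrite <- Cmod2_conj, Hmu, pow1; ring.
Qed.

(** The hypothesis on [lambda] says [- lambda conj b0 = b0], so that
    [z |-> - lambda conj z] fixes [b0] and commutes with [phi], while
    composing [psi] with it gives the conjugate of [psi]. *)
Lemma wc_conj_J_rotate (b0 lambda : C) (b1 b2 : R) (f : C -> C) (z : C) :
  disk b0 -> (forall z, disk z -> disk (phi b0 b1 z)) ->
  Cmod lambda = 1%R -> lambda * Cconj b0 + b0 = 0 -> disk z ->
  Cconj (weighted_comp (psi b0 b2) (phi b0 b1) f (- lambda * Cconj z)) =
  psi b0 b2 z * Cconj (f (- lambda * Cconj (phi b0 b1 z))).
Proof.
intros Hb Hphi Hl Hlb Hz.
assert (D1 := disk_denom _ _ Hb Hz).
assert (D2 := disk_denom_conj _ _ Hb Hz).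
assert (Eb : - lambda * Cconj b0 = b0).
{ replace (- lambda * Cconj b0) with (b0 - (lambda * Cconj b0 + b0)) by ring.
  rewrite Hlb; ring. }
assert (E2 : 1 - Cconj b0 * (- lambda * Cconj z) = 1 - b0 * Cconj z)
  by (rewrite <- Eb at 2; ring).
assert (Ephi : phi b0 b1 (- lambda * Cconj z) = - lambda * Cconj (phi b0 b1 z)).
{ unfold phi; rewrite E2, Cplus_conj, Cdiv_conj, Cmult_conj, Cconj_denom, Cconj_RtoC by exact D1.
  rewrite <- Eb at 1; field; exact D2. }
unfold weighted_comp; rewrite Cmult_conj, Ephi; f_equal.
unfold psi; rewrite E2, Cdiv_conj, <- Cconj_denom, Cconj_conj, Cconj_RtoC by exact D2; reflexivity.
Qed.

Theorem theorem3 (b0 : C) (b1 b2 : R) :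
  disk b0 ->
  let phi := fun z : C => b0 + RtoC b1 * z / (1 - Cconj b0 * z) in
  let psi := fun z : C => RtoC b2 / (1 - Cconj b0 * z) in
  holomorphic_self_map phi ->
  hermitian (weighted_comp psi phi) /\
  (forall lambda : C,
     Cmod lambda = 1%R ->
     lambda * Cconj b0 + b0 = 0 ->
     complex_symmetric_with (weighted_comp psi phi)
       (fun f => conj_J (comp_op (fun z => - lambda * z) f))).
Proof.
intros Hb phi' psi' [_ Hphi].
change psi' with (psi b0 b2); change phi' with (phi b0 b1) in *; clear phi' psi'.
assert (HW := wc_hermitian b0 b1 b2 Hb Hphi).
split; [exact HW|]; intros lambda Hl Hlb.
assert (Hmu : Cmod (- lambda) = 1%R) by now rewrite Cmod_opp.
destruct HW as [HW Hadj].
split; [exact HW|split; [now apply conjugation_conj_J_rotate|]].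
exists (weighted_comp (psi b0 b2) (phi b0 b1)); split; [exact HW|split; [exact Hadj|]].
intros f Hf z Hz.
destruct (conj_J_rotate _ _ Hmu (proj1 (proj1 HW) f Hf)) as [_ [_ ->]]; [|exact Hz].
unfold weighted_comp at 2.
destruct (conj_J_rotate _ _ Hmu Hf) as [_ [_ ->]]; [|now apply Hphi].
now apply wc_conj_J_rotate.
Qed.
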